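(* Let $k$ be a commutative associative unital ring, let $A$ be a pro-nilpotent $k$-algebra, let $h:A\to B$ be a surjective homomorphism of $k$-algebras, so that $B=h(A)$. Then: (i) For every $r\in M(B)$, the operator $1+r\in\operatorname{Endo}(B)$ is surjective. (More generally, for every integer $n>0$ and every $r\in\operatorname{Mat}_n(M(B))$, $1+r$ acts surjectively on the direct sum $\bigoplus_n B$ of $n$ copies of $B$.) (ii) If $B$ is Hopfian as a $k$-module, then $M(B)$ is contained in a Jacobson radical subalgebra of $\operatorname{Endo}(B)$. (iii) If $B$ is of finite length as a $k$-module, then $B$ is nilpotent as an algebra.
   Context: Here a $k$-algebra means a $k$-module with a $k$-bilinear multiplication, not necessarily associative or unital. An algebra $A$ is nilpotent if for some $n>0$ all products of $n$ elements of $A$, no matter how bracketed, are zero. An algebra is pro-nilpotent if it can be written as an inverse limit (over an inversely directed partially ordered set) of nilpotent $k$-algebras; no surjectivity of the connecting maps or of the projection maps is assumed. For an algebra $A$, $\operatorname{Endo}(A)$ denotes the associative unital $k$-algebra of all $k$-module endomorphisms of $A$ (not algebra endomorphisms). For $x\in A$, $l_x,r_x\in\operatorname{Endo}(A)$ are given by $l_x(y)=xy$, $r_x(y)=yx$. The multiplication algebra $M(A)$ is the (generally nonunital) subalgebra of $\operatorname{Endo}(A)$ generated by all $l_x$ and $r_x$, $x\in A$. Matrices over $M(A)$ act on $\bigoplus_n A$ in the obvious way (column vectors), and $1$ denotes the identity operator. Subalgebras need not be unital. A (nonunital) associative algebra $R$ is Jacobson radical if every $x\in R$ is quasiinvertible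 in $R$, i.e. there is $y\in R$ with $x+y+xy=0=x+y+yx$. A module is Hopfian if every surjective module endomorphism of it is an automorphism. *)

(* Defs.v *)
From HB Require Import structures.
From mathcomp Require Import all_boot all_order all_algebra.
From mathcomp Require Import boolp classical_sets.

Set Implicit Arguments.
Unset Strict Implicit.
Unset Printing Implicit Defensive.

Import Order.TTheory GRing.Theory.
Local Open Scope ring_scope.
Local Open Scope classical_set_scope.

Definition surjective (T U : Type) (f : T -> U) : Prop :=
  forall y, exists x, f x = y.

(** A k-algebra in the weak sense: neither associativity nor a unit. *)

HB.mixin Record Lmodule_isNonassocAlgebra (k : comPzRingType) A
    of GRing.Lmodule k A := {
  namul : A -> A -> A;
  namul_linear_r : forall x, linear (namul x);
  namul_linear_l : forall y, linear (namul^~ y)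
}.

#[short(type="nonassocAlgType")]
HB.structure Definition NonassocAlgebra (k : comPzRingType) :=
  {A of GRing.Lmodule k A & Lmodule_isNonassocAlgebra k A}.

Notation "x ** y" := (namul x y) (at level 40, left associativity).

(** Membership in [is_product A n] means: being a product of n elements of A,
    for some choice of the elements and of the bracketing. *)
Inductive is_product (k : comPzRingType) (A : nonassocAlgType k) :
    nat -> A -> Prop :=
| is_product_one (x : A) : is_product 1 x
| is_product_mul (m n : nat) (x y : A) :
    is_product m x -> is_product n y -> is_product (m + n) (x ** y).

Definition nilpotent_alg (k : comPzRingType) (A : nonassocAlgType k) : Prop :=
  exists2 n : nat, (0 < n)%N & forall x : A, is_product n x -> x = 0.

(** Connecting maps go upwards in the order, so the index poset of an inverse
    limit is directed downwards. *)

Definition inversely_directed (d : Order.disp_t) (I : porderType d) : Prop :=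
  inhabited I /\ forall i j : I, exists l : I, (l <= i)%O && (l <= j)%O.

Definition is_inverse_system (k : comPzRingType) (d : Order.disp_t)
    (I : porderType d) (F : I -> nonassocAlgType k)
    (f : forall i j : I, (i <= j)%O -> {linear F i -> F j}) : Prop :=
  [/\ forall (i j : I) (ij : (i <= j)%O), {morph f i j ij : x y / x ** y},
      forall (i : I) (ii : (i <= i)%O) (x : F i), f i i ii x = x &
      forall (i j l : I) (ij : (i <= j)%O) (jl : (j <= l)%O) (il : (i <= l)%O)
        (x : F i), f j l jl (f i j ij x) = f i l il x].

(** The maps p i identify A with the algebra of compatible families in the
    product of the F i. *)
Definition is_inverse_limit (k : comPzRingType) (d : Order.disp_t)
    (I : porderType d) (F : I -> nonassocAlgType k)
    (f : forall i j : I, (i <= j)%O -> {linear F i -> F j})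
    (A : nonassocAlgType k) (p : forall i : I, {linear A -> F i}) : Prop :=
  [/\ forall i : I, {morph p i : x y / x ** y},
      forall (i j : I) (ij : (i <= j)%O) (a : A), f i j ij (p i a) = p j a &
      forall t : forall i : I, F i,
        (forall (i j : I) (ij : (i <= j)%O), f i j ij (t i) = t j) ->
        exists! a : A, forall i : I, p i a = t i].

Definition pro_nilpotent (k : comPzRingType) (A : nonassocAlgType k) : Prop :=
  exists (d : Order.disp_t) (I : porderType d) (F : I -> nonassocAlgType k)
    (f : forall i j : I, (i <= j)%O -> {linear F i -> F j})
    (p : forall i : I, {linear A -> F i}),
    [/\ inversely_directed I, forall i : I, nilpotent_alg (F i),
        is_inverse_system f & is_inverse_limit f p].

(** Endo(V) with composition as product. It is trivial when V is, so it is a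
    [pzRingType] and an [lmodType] but not an [algType]; the lemmas [endo_scaleAl]
    and [endo_scaleAr] supply the remaining algebra axioms. *)

Definition endo (k : comPzRingType) (V : lmodType k) : Type := {linear V -> V}.

Definition endo_fun (k : comPzRingType) (V : lmodType k) (f : endo V) : V -> V :=
  GRing.Linear.sort f.
Coercion endo_fun : endo >-> Funclass.

Section EndoAlgebra.
Variables (k : comPzRingType) (V : lmodType k).
Implicit Types f g : endo V.

Lemma endo_linear f : linear f.
Proof. exact: linearP. Qed.

HB.instance Definition _ f :=
  GRing.isLinear.Build k V V *:%R (endo_fun f) (endo_linear f).

Lemma endo_ext f g : f =1 g -> f = g.
Proof.
case: f g => [f [[f0] [f1]]] [g [[g0] [g1]]] /= /funext fg.
rewrite /endo_fun /= in fg; case: _ / fg in g0 g1 *.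
by rewrite (Prop_irrelevance g0 f0) (Prop_irrelevance g1 f1).
Qed.

Definition mk_endo (u : V -> V) (lu : linear u) : endo V :=
  HB.pack u (GRing.isLinear.Build k V V *:%R u lu).

Lemma endo_zero_linear : linear (fun _ : V => 0 : V).
Proof. by move=> a x y; rewrite scaler0 addr0. Qed.

Lemma endo_one_linear : linear (fun x : V => x).
Proof. by []. Qed.

Lemma endo_opp_linear f : linear (fun x => - f x).
Proof. by move=> a x y; rewrite endo_linear opprD scalerN. Qed.

Lemma endo_add_linear f g : linear (fun x => f x + g x).
Proof. by move=> a x y; rewrite !endo_linear scalerDr addrACA. Qed.

Lemma endo_mul_linear f g : linear (fun x => f (g x)).
Proof. by move=> a x y; rewrite !endo_linear. Qed.

Lemma endo_scale_linear (c : k) f : linear (fun x => c *: f x).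
Proof. by move=> a x y; rewrite endo_linear scalerDr !scalerA mulrC. Qed.

HB.instance Definition _ := gen_eqMixin (endo V).
HB.instance Definition _ := gen_choiceMixin (endo V).

Fact endo_addA : associative (fun f g => mk_endo (endo_add_linear f g)).
Proof. by move=> f g h; apply: endo_ext => x; exact: addrA. Qed.

Fact endo_addC : commutative (fun f g => mk_endo (endo_add_linear f g)).
Proof. by move=> f g; apply: endo_ext => x; exact: addrC. Qed.

Fact endo_add0 : left_id (mk_endo endo_zero_linear)
  (fun f g => mk_endo (endo_add_linear f g)).
Proof. by move=> f; apply: endo_ext => x; exact: add0r. Qed.

Fact endo_addN : left_inverse (mk_endo endo_zero_linear)
  (fun f => mk_endo (endo_opp_linear f))
  (fun f g => mk_endo (endo_add_linear f g)).
Proof. by move=> f; apply: endo_ext => x; exact: addNr. Qed.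

HB.instance Definition _ := GRing.isZmodule.Build (endo V)
  endo_addA endo_addC endo_add0 endo_addN.

Fact endo_mulA : associative (fun f g => mk_endo (endo_mul_linear f g)).
Proof. by move=> f g h; apply: endo_ext. Qed.

Fact endo_mul1f : left_id (mk_endo endo_one_linear)
  (fun f g => mk_endo (endo_mul_linear f g)).
Proof. by move=> f; apply: endo_ext. Qed.

Fact endo_mulf1 : right_id (mk_endo endo_one_linear)
  (fun f g => mk_endo (endo_mul_linear f g)).
Proof. by move=> f; apply: endo_ext. Qed.

Fact endo_mulDl :
  left_distributive (fun f g => mk_endo (endo_mul_linear f g)) +%R.
Proof. by move=> f g h; apply: endo_ext. Qed.

Fact endo_mulDr :
  right_distributive (fun f g => mk_endo (endo_mul_linear f g)) +%R.
Proof. by move=> f g h; apply: endo_ext => x; exact: linearD. Qed.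

HB.instance Definition _ := GRing.Zmodule_isPzRing.Build (endo V)
  endo_mulA endo_mul1f endo_mulf1 endo_mulDl endo_mulDr.

Fact endo_scaleA (a b : k) f :
  mk_endo (endo_scale_linear a (mk_endo (endo_scale_linear b f)))
  = mk_endo (endo_scale_linear (a * b) f).
Proof. by apply: endo_ext => x; exact: scalerA. Qed.

Fact endo_scale1 : left_id 1 (fun c f => mk_endo (endo_scale_linear c f)).
Proof. by move=> f; apply: endo_ext => x; exact: scale1r. Qed.

Fact endo_scaleDr :
  right_distributive (fun c f => mk_endo (endo_scale_linear c f)) +%R.
Proof. by move=> c f g; apply: endo_ext => x; exact: scalerDr. Qed.

Fact endo_scaleDl f :
  {morph (fun c => mk_endo (endo_scale_linear c f)) : a b / a + b}.
Proof. by move=> a b; apply: endo_ext => x; exact: scalerDl. Qed.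

HB.instance Definition _ := GRing.Zmodule_isLmodule.Build k (endo V)
  endo_scaleA endo_scale1 endo_scaleDr endo_scaleDl.

Lemma endo_scaleAl (a : k) f g : a *: (f * g) = (a *: f) * g.
Proof. by apply: endo_ext. Qed.

Lemma endo_scaleAr (a : k) f g : a *: (f * g) = f * (a *: g).
Proof. by apply: endo_ext => x; apply/esym/linearZ. Qed.

Lemma endo_oneE x : (1 : endo V) x = x. Proof. by []. Qed.
Lemma endo_addE f g x : (f + g) x = f x + g x. Proof. by []. Qed.
Lemma endo_mulE f g x : (f * g) x = f (g x). Proof. by []. Qed.
Lemma endo_scaleE (a : k) f x : (a *: f) x = a *: f x. Proof. by []. Qed.

End EndoAlgebra.

(** Subalgebras of Endo(V) need not contain the identity. *)
Definition is_subalgebra (k : comPzRingType) (V : lmodType k)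
    (S : set (endo V)) : Prop :=
  submod_closed (mem S) /\ GRing.mulr_2closed (mem S).

Definition lmul (k : comPzRingType) (A : nonassocAlgType k) (x : A) : endo A :=
  mk_endo (namul_linear_r x).

Definition rmul (k : comPzRingType) (A : nonassocAlgType k) (x : A) : endo A :=
  mk_endo (namul_linear_l x).

(** The multiplication algebra M(A). *)
Definition mult_alg (k : comPzRingType) (A : nonassocAlgType k) :
    set (endo A) :=
  smallest (@is_subalgebra k A) (range (@lmul k A) `|` range (@rmul k A)).
Arguments mult_alg {k} A _.

Definition endo_mx_act (k : comPzRingType) (V : lmodType k) (n : nat)
    (r : 'M[endo V]_n) (v : 'cV[V]_n) : 'cV[V]_n :=
  \col_i \sum_j r i j (v j 0).

(** Quasiinverses are required to lie in S itself. *)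
Definition jacobson_radical (k : comPzRingType) (V : lmodType k)
    (S : set (endo V)) : Prop :=
  forall x : endo V, S x ->
    exists2 y : endo V, S y & x + y + x * y = 0 /\ x + y + y * x = 0.

Definition hopfian (k : comPzRingType) (V : lmodType k) : Prop :=
  forall f : endo V, surjective f -> bijective f.

(** Finite length: existence of a composition series
    0 = N 0 < N 1 < ... < N n = V whose inclusions admit no strictly
    intermediate submodule; the values N i for i > n play no role. *)
Definition finite_length (k : comPzRingType) (V : lmodType k) : Prop :=
  exists (n : nat) (N : nat -> set V),
    [/\ forall i : nat, (i <= n)%N -> submod_closed (mem (N i)),
        N 0%N = [set 0], N n = [set: V] &
        forall i : nat, (i < n)%N ->
          N i `<` N i.+1 /\
          forall L : set V, submod_closed (mem L) ->
            N i `<=` L -> L `<=` N i.+1 -> L = N i \/ L = N i.+1].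

(* Main.v *)
(** Call an endomorphism r of B liftable if it comes from an endomorphism of A
    that is compatible with endomorphisms r_i of the nilpotent algebras F i,
    each of which raises the filtration of F i by powers. Liftable
    endomorphisms form a subalgebra S containing all left and right
    multiplications, hence M(B). Each 1 + r_i is invertible because r_i is
    nilpotent, and the solutions of (1 + r_i) v = w glue in the inverse limit;
    so 1 + r is onto for r over S, also in matrix form. If B is Hopfian, 1 + r
    is invertible, and its inverse is lifted by the inverses on A and on the
    F i, so S itself is Jacobson radical. If B has finite length, then B is
    Hopfian, and the radical algebra S annihilates every simple S-module
    subquotient of B, so B is nilpotent. *)

Require Import Defs.
From mathcomp Require Import all_boot all_order all_algebra.
From mathcomp Require Import boolp classical_sets.
Import GRing.Theory.
Local Open Scope ring_scope.
Local Open Scope classical_set_scope.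

Set Implicit Arguments.
Unset Strict Implicit.
Unset Printing Implicit Defensive.

(** * Submodules, finite length and the Hopfian property *)

Section EndoMorphism.
Variables (k : comPzRingType) (V : lmodType k) (f : endo V).

Lemma endoB x y : f (x - y) = f x - f y. Proof. exact: linearB. Qed.
Lemma endoN x : f (- x) = - f x. Proof. exact: linearN. Qed.
Lemma endo0 : f 0 = 0. Proof. exact: linear0. Qed.

End EndoMorphism.

Section Submodules.
Variables (k : comPzRingType) (V : lmodType k).
Implicit Types L : set V.

Lemma submod_setP L :
  submod_closed (mem L) <->
  L 0 /\ forall a u v, L u -> L v -> L (a *: u + v).
Proof.
split=> [[L0 LZD]|[L0 LZD]].
  split=> [|a u v Lu Lv]; first by have := L0; rewrite !inE.
  have := LZD a u v; rewrite !inE; exact.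
by split=> [|a u v]; rewrite !inE //; exact: LZD.
Qed.

Section Closure.
Variables (L : set V) (Lsub : submod_closed (mem L)).

Lemma submod0 : L 0. Proof. by have [] := (submod_setP L).1 Lsub. Qed.

Lemma submodZD a u v : L u -> L v -> L (a *: u + v).
Proof. by have [_] := (submod_setP L).1 Lsub; apply. Qed.

Lemma submodD u v : L u -> L v -> L (u + v).
Proof. by rewrite -{2}[u]scale1r; exact: submodZD. Qed.

Lemma submodB u v : L u -> L v -> L (u - v).
Proof. by move=> Lu Lv; rewrite addrC -scaleN1r; exact: submodZD. Qed.

Lemma submodN u : L u -> L (- u).
Proof. by rewrite -sub0r; apply: submodB submod0. Qed.

Lemma submod_sum (I : finType) (F : I -> V) :
  (forall i, L (F i)) -> L (\sum_i F i).
Proof. by move=> LF; apply: big_ind => //; [exact: submod0|exact: submodD]. Qed.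

End Closure.

Lemma submod_zero : submod_closed (mem [set 0 : V]).
Proof. by apply/submod_setP; split=> // a u v -> ->; rewrite scaler0 addr0. Qed.

Lemma submod_full : submod_closed (mem [set: V]).
Proof. exact/submod_setP. Qed.

(* ell L counts the composition factors of V that L meets. *)
Lemma finite_length_rank : finite_length V ->
  exists ell : set V -> nat, forall L L',
    submod_closed (mem L) -> submod_closed (mem L') -> L `<=` L' ->
    (ell L <= ell L')%N /\ (L' `<=` L \/ (ell L < ell L')%N).
Proof.
move=> [n [N [Nsub N0 Nn Nmax]]].
(* The i-th factor is met when [L] intersected with [N i.+1] has nonzero image in the quotient of
   [N i.+1] by [N i]. For [L] inside [L'], meeting the same factors will force equality. *)
pose meets L i := `[< ~ (L `&` N i.+1 `<=` N i) >].
exists (fun L => \sum_(i < n) meets L i)%N => L L' Ls L's LL'.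
have le i : (meets L i <= meets L' i)%N.
  rewrite /meets; case: asboolP => //= nL; rewrite asboolT // => L'i.
  by apply: nL => x [Lx Nx]; apply: L'i; split => //; exact: LL'.
split; first exact: leq_sum.
have [/existsP[i lt_i]|/existsPn eqLL'] :=
  boolP [exists i : 'I_n, (meets L i < meets L' i)%N].
  right; rewrite (bigD1 i) //= [ltnRHS](bigD1 i) //=.
  by rewrite -addSn leq_add // leq_sum.
left; suff sub i : (i <= n)%N -> L' `&` N i `<=` L.
  by move=> x L'x; apply: (sub n) => //; rewrite Nn.
elim: i => [_|i IHi lt_in]; first by rewrite N0 => x [_ ->]; exact: submod0.
have Ni := Nsub i (ltnW lt_in); have NSi := Nsub i.+1 lt_in.
have [[NiSi nNSii] maxi] := Nmax i lt_in.
have {eqLL'} := eqLL' (Ordinal lt_in); rewrite -leqNgt /meets /=.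
case: (asboolP (~ (L' `&` _ `<=` _))) => [_|/contrapT L'N _]; last first.
  by move=> x [L'x Nx]; apply: IHi; [exact: ltnW|split=> //; exact: L'N].
case: asboolP => // nLN _ x [L'x Nx].
(* [Q] is [N i] plus the part of [L] inside [N i.+1]. As [L] meets this factor, maximality gives
   [Q = N i.+1], so [x] differs from an element of [L] by an element of [L'] in [N i], to which
   induction applies. *)
pose Q := [set z | exists2 l, (L `&` N i.+1) l & N i (z - l)].
have Qs : submod_closed (mem Q).
  apply/submod_setP; split.
    exists 0; first by split; exact: submod0.
    by rewrite subr0; exact: submod0.
  move=> a u v [lu [Llu Nlu] Nu] [lv [Llv Nlv] Nv].
  exists (a *: lu + lv); first by split; apply: submodZD.
  have -> : a *: u + v - (a *: lu + lv) = a *: (u - lu) + (v - lv).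
    by rewrite scalerBr opprD addrACA.
  exact: submodZD.
have NQ : N i `<=` Q.
  move=> z Nz; exists 0; first by split; exact: submod0.
  by rewrite subr0.
have QN : Q `<=` N i.+1.
  move=> z [l [_ Nl] Nzl]; rewrite -(subrK l z).
  by apply: submodD => //; exact: NiSi.
have [QE|QE] := maxi Q Qs NQ QN.
  case: nLN => z [Lz Nz]; rewrite -QE; exists z => //.
  by rewrite subrr; exact: submod0.
have [l [Ll Nl] Nxl] : Q x by rewrite QE.
rewrite -(subrK l x); apply: submodD => //.
by apply: IHi; [exact: ltnW|split=> //; apply: submodB => //; exact: LL'].
Qed.

(** If a surjective [f] kills some nonzero [x], a preimage of [x] under the m-th iterate lies in the
    kernel of the next iterate but not in that of the m-th. The kernels then grow forever and
    outgrow the rank of [V]. *)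
Lemma finite_length_hopfian : finite_length V -> hopfian V.
Proof.
move=> /finite_length_rank[ell ellP] f fsurj.
have finj : injective f.
  suff ker0 x : f x = 0 -> x = 0.
    by move=> x y fxy; apply/subr0_eq/ker0; rewrite endoB fxy subrr.
  move=> fx0; apply: contrapT => x0.
  pose K m := [set y | iter m f y = 0].
  have iter0 m : iter m f 0 = 0 by elim: m => //= m ->; rewrite endo0.
  have Ks m : submod_closed (mem (K m)).
    apply/submod_setP; split; first exact: iter0.
    rewrite /K /= => a u v Ku Kv.
    suff -> : iter m f (a *: u + v) = a *: iter m f u + iter m f v.
      by rewrite Ku Kv scaler0 addr0.
    by elim: (m) => //= j ->; rewrite endo_linear.
  have iter_surj m : exists y, iter m f y = x.
    elim: m => [|m [y yx]]; first by exists x.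
    by have [z zy] := fsurj y; exists z; rewrite iterSr zy.
  have ellK m : (m <= ell (K m))%N.
    elim: m => // m IHm.
    have [|_ [KS|lt]] := ellP (K m) (K m.+1) (Ks m) (Ks m.+1).
    - by move=> y; rewrite /K /= => ->; rewrite endo0.
    - have [y yx] := iter_surj m; case: x0; rewrite -yx; apply: KS.
      by rewrite /K /= yx.
    - exact: leq_ltn_trans IHm lt.
  pose m := (ell [set: V]).+1.
  have [le _] := ellP (K m) setT (Ks m) submod_full (@subsetT _ _).
  by have := leq_trans (ellK m) le; rewrite ltnn.
have [g gK] := choice fsurj.
by exists g => // x; apply: finj; rewrite gK.
Qed.

End Submodules.

Lemma endo_inverse (k : comPzRingType) (V : lmodType k) (f : endo V) :
  surjective f -> injective f -> exists g : endo V, cancel f g /\ cancel g f.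
Proof.
move=> /choice[g gK] finj.
have lg : linear g.
  by move=> a x y; apply: finj; rewrite endo_linear !gK.
by exists (mk_endo lg); split=> x; [apply: finj|]; exact: gK.
Qed.

(** * Long products and radical algebras of operators *)

Lemma is_product_shorten (k : comPzRingType) (A : nonassocAlgType k)
    (m j : nat) (x : A) :
  (0 < j <= m)%N -> is_product m x -> is_product j x.
Proof.
move=> jm xm; elim: xm j jm => [y j|m1 m2 y z ym IHy zm IHz j].
  by rewrite -eqn_leq => /eqP <-; constructor.
have m0 i (u : A) : is_product i u -> (0 < i)%N.
  by elim=> // i1 i2 ? ? _ i1_gt0 *; rewrite addn_gt0 i1_gt0.
have [m1_gt0 m2_gt0] := (m0 _ _ ym, m0 _ _ zm).
move=> /andP[]; case: j => // -[|j] _ jm; first exact: is_product_one.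
(* Subproducts may count as single factors. Of the wanted [j.+2] factors the left side supplies as
   many as it can, but at most [j.+1], so that at least one is left for the right side. *)
pose i := minn m1 j.+1.
have ij : (i <= j.+1)%N by rewrite geq_minr.
rewrite -(subnKC (leqW ij)); constructor.
  by apply: IHy; rewrite leq_min m1_gt0 geq_minl.
apply: IHz; rewrite subSn //= /i; case: (leqP m1 j.+1) => [le|lt].
  by rewrite -subSn // leq_subLR.
by rewrite subnn.
Qed.

(* A submodule interval without intermediate stable submodules is annihilated
   by S; refining {0} <= B into such intervals bounds the nonzero products. *)
Section RadicalFiniteLength.
Variables (k : comPzRingType) (B : nonassocAlgType k) (S : set (endo B)).
Hypotheses (Ssub : is_subalgebra S) (Srad : jacobson_radical S).
Hypotheses (Sl : forall x : B, S (lmul x)) (Sr : forall x : B, S (rmul x)).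

Definition stable_submod (N : set B) :=
  submod_closed (mem N) /\ forall s x, S s -> N x -> N (s x).

(** A Nakayama argument: [S x + N'] is stable, hence is contained in [N'] or contains [N]. In the
    second case [x = t x] modulo [N'] for some [t] in [S], and invertibility of [1 - t] puts [x]
    itself in [N']. *)
Lemma simple_interval_annihilated (N' N : set B) :
  stable_submod N' -> stable_submod N -> N' `<=` N ->
  (forall L, stable_submod L -> N' `<=` L -> L `<=` N ->
    L `<=` N' \/ N `<=` L) ->
  forall s x, S s -> N x -> N' (s x).
Proof.
move=> [N's N'S] [Ns NS] N'N simple s x Ss Nx.
have [Sadd Smul] := Ssub.
pose L := [set z | exists2 t, S t & N' (z - t x)].
have Lst : stable_submod L.
  split.
    apply/submod_setP; split.
      exists 0; first exact: submod0.
      by rewrite subr0; exact: submod0.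
    move=> a u v [t St N't] [t' St' N't'].
    exists (a *: t + t'); first exact: submodZD.
    have -> : a *: u + v - (a *: t + t') x = a *: (u - t x) + (v - t' x).
      by rewrite endo_addE endo_scaleE scalerBr opprD addrACA.
    exact: submodZD.
  move=> t z St [t' St' N'z]; exists (t * t').
    by have := Smul t t'; rewrite !inE; exact.
  by rewrite endo_mulE -endoB; exact: N'S.
have N'L : N' `<=` L.
  by move=> z N'z; exists 0; [exact: submod0|rewrite subr0].
have LN : L `<=` N.
  move=> z [t St N'z]; rewrite -(subrK (t x) z).
  by apply: submodD => //; [exact: N'N|exact: NS].
have [LN'|NL] := simple L Lst N'L LN.
  by apply: LN'; exists s => //; rewrite subrr; exact: submod0.
apply: (N'S) => //.
have [t St N'xt] := NL x Nx.
(* The quasiinverse [q] of [- t] satisfies [(1 + q) (1 - t) = 1]. *)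
have [q Sq [_ qE]] := Srad (submodN Sadd St).
suff -> : x = (x - t x) + q (x - t x) by apply: submodD => //; exact: N'S.
have : (- t + q + q * - t) x = 0 by rewrite qE.
have -> : (- t + q + q * - t) x = - t x + q x - q (t x).
  by rewrite !endo_addE endo_mulE; congr (_ + _); exact: endoN.
by move=> qx; rewrite endoB -addrA [- _ + _]addrA qx addr0.
Qed.

(** Powers of two fit the splitting of a product at its outermost multiplication. The gain [d] is
    uniform in [c], so that drops compose by adding gains. *)
Definition product_drop (N' N : set B) := exists d, forall c,
  (forall x, is_product (2 ^ c) x -> N x) ->
  forall x, is_product (2 ^ (c + d)) x -> N' x.

Lemma product_drop_trans (N1 N2 N3 : set B) :
  product_drop N1 N2 -> product_drop N2 N3 -> product_drop N1 N3.
Proof.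
move=> [d1 drop1] [d2 drop2]; exists (d2 + d1)%N => c N3c.
by rewrite addnA; apply: drop1; exact: drop2.
Qed.

(** One of the two outermost factors has length at least [2 ^ c], hence lies in [N]; multiplication
    by the other one is an operator in [S]. *)
Lemma product_drop_step (N' N : set B) :
  (forall s x, S s -> N x -> N' (s x)) -> product_drop N' N.
Proof.
move=> SN; exists 1%N => c Nc x; rewrite addn1.
move e : (2 ^ c.+1)%N => m xm; case: xm e => [y|m1 m2 y z ym zm] e.
  by have := ltn_expl c.+1 (ltnSn 1); rewrite e.
have c0 : (0 < 2 ^ c)%N by rewrite expn_gt0.
have [le1|lt1] := leqP (2 ^ c) m1.
  apply: (SN (rmul z)) => //; apply: Nc.
  by apply: is_product_shorten ym; rewrite c0.
apply: (SN (lmul y)) => //; apply: Nc.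
apply: is_product_shorten zm; rewrite c0 /= -(leq_add2l m1) -e expnS mul2n.
by rewrite -addnn leq_add2r ltnW.
Qed.

Lemma radical_nilpotent_alg : finite_length B -> nilpotent_alg B.
Proof.
move=> /finite_length_rank[ell ellP].
(* Induction on the rank gap: a stable submodule strictly in between splits it into two smaller
   gaps; if there is none, [S] annihilates the interval. *)
have drop l : forall N' N, stable_submod N' -> stable_submod N -> N' `<=` N ->
    (ell N - ell N' < l)%N -> product_drop N' N.
  elim: l => // l IHl N' N N'st Nst N'N gap.
  have [[L [Lst [N'L LN nLN' nNL]]]|simple] := pselect (exists L,
    stable_submod L /\ [/\ N' `<=` L, L `<=` N, ~ L `<=` N' & ~ N `<=` L]).
    have [_ [//|ltL]] := ellP N' L N'st.1 Lst.1 N'L.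
    have [_ [//|ltN]] := ellP L N Lst.1 Nst.1 LN.
    apply: (product_drop_trans (N2 := L)); apply: IHl => //.
      apply: leq_trans (gap : (_ <= l)%N).
      exact: ltn_sub2r (ltn_trans ltL ltN) ltN.
    apply: leq_trans (gap : (_ <= l)%N).
    exact: ltn_sub2l (ltn_trans ltL ltN) ltL.
  apply: product_drop_step.
  apply: (simple_interval_annihilated N'st Nst N'N) => L Lst N'L LN.
  have [|nLN'] := pselect (L `<=` N'); first by left.
  have [|nNL] := pselect (N `<=` L); first by right.
  by case: simple; exists L.
have zero_st : stable_submod [set 0].
  by split=> [|s x _ ->]; [exact: submod_zero|exact: endo0].
have full_st : stable_submod [set: B] by split=> //; exact: submod_full.
have [d dP] := drop _ _ _ zero_st full_st (@subsetT _ _) (ltnSn _).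
(* At [c = 0] the premise is trivial, the upper submodule being all of [B]. *)
by exists (2 ^ (0 + d))%N; [rewrite expn_gt0|exact: dP].
Qed.

End RadicalFiniteLength.

(** * Inverting one plus an operator that raises a finite filtration *)

Lemma inverse_intertwine (k : comPzRingType) (V W : lmodType k)
    (f : {linear V -> W}) (r g : endo V) (s e : endo W) :
  (forall x, f (r x) = s (f x)) -> cancel g (1 + r : endo V) ->
  cancel (1 + s : endo W) e ->
  forall x, f ((g - 1) x) = (e - 1) (f x).
Proof.
move=> fr gK sK x; rewrite [LHS]linearB; congr (_ - _).
(* Here [f g = e (1 + s) f g = e f (1 + r) g = e f]. *)
by rewrite -{2}(gK x) endo_addE linearD fr; exact/esym/sK.
Qed.

Section StrictOperator.
Variables (V : zmodType) (U : nat -> set V) (T : V -> V) (N : nat).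
Hypotheses (U0 : forall v, U 0 v) (UN : forall v, U N v -> v = 0)
  (Uanti : forall m v, U m.+1 v -> U m v)
  (UB : forall m u v, U m u -> U m v -> U m (u - v))
  (TB : {morph T : u v / u - v}) (TU : forall m v, U m v -> U m.+1 (T v)).

(** If [u] and [v] have the same image, then [u - v = - T (u - v)], so [u - v] sinks level by level
    into [U N]. *)
Lemma strict_injective : injective (fun v => v + T v).
Proof.
move=> u v /= uv; apply/subr0_eq/UN.
have e : u - v = 0 - T (u - v).
  apply/eqP; rewrite sub0r -addr_eq0 TB addrACA -opprD.
  by rewrite uv subrr.
elim: N => [|m IHm]; first exact: U0.
rewrite e; apply: UB (TU IHm).
rewrite -(subrr (T (u - v))); apply: UB; exact: TU.
Qed.

(** A finite Neumann series: [w] is corrected by the solution for [- T w], which lives one level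
    deeper. Keeping the solution in [U m] later shows that quasiinverses raise powers. *)
Lemma strict_solve m w : U m w -> exists2 v, U m v & v + T v = w.
Proof.
have T0 : T 0 = 0 by have := TB 0 0; rewrite !subrr.
have [d le_Nd] : exists d, (N <= m + d)%N by exists N; rewrite leq_addl.
elim: d m w le_Nd => [|d IHd] m w.
  rewrite addn0 => le_Nm Umw.
  have w0 : w = 0.
    apply: UN; move: Umw; rewrite -(subnK le_Nm).
    by elim: (m - N)%N => // i IHi /Uanti.
  by exists w => //; rewrite w0 add0r T0.
rewrite addnS -addSn => /IHd {}IHd Umw.
have Um0 : U m.+1 0 by rewrite -(subrr (T w)); apply: UB; exact: TU.
have [v Uv vT] := IHd (0 - T w) (UB Um0 (TU Umw)).
(* This is [w + v], written so that closure under differences applies. *)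
exists (w - (0 - v)); first by apply: UB => //; apply/Uanti/UB.
by rewrite !TB T0 !sub0r !opprK addrACA vT sub0r addrK.
Qed.

End StrictOperator.

(** * The filtration of an algebra by its powers *)

Section PowerFiltration.
Variables (k : comPzRingType) (F : nonassocAlgType k).

(* The index is shifted: power_submod 0 is all of F. *)
Definition power_submod (m : nat) : set F :=
  smallest (fun L => submod_closed (mem L))
    [set x | exists2 j, (m < j)%N & is_product j x].

Definition raises_powers (r : endo F) :=
  forall m x, power_submod m x -> power_submod m.+1 (r x).

Lemma power_submod_closed m : submod_closed (mem (power_submod m)).
Proof.
apply/submod_setP; split=> [L [Ls _]|a u v Uu Uv L [Ls GL]].
  exact: submod0.
by apply: submodZD => //; [exact: Uu|exact: Uv].
Qed.

Lemma power_submod_product m j x :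
  (m < j)%N -> is_product j x -> power_submod m x.
Proof. by move=> mj xj L [_]; apply; exists j. Qed.

Lemma power_submod_min m (L : set F) : submod_closed (mem L) ->
  (forall j x, (m < j)%N -> is_product j x -> L x) -> power_submod m `<=` L.
Proof. by move=> Ls GL x; apply; split=> // y [j mj yj]; exact: GL yj. Qed.

Lemma power_submod0 x : power_submod 0 x.
Proof. by apply: (@power_submod_product _ 1) => //; constructor. Qed.

Lemma power_submodS m x : power_submod m.+1 x -> power_submod m x.
Proof.
apply: power_submod_min; first exact: power_submod_closed.
by move=> j y mj; apply: power_submod_product; exact: ltnW.
Qed.

Lemma power_submod_nilpotent :
  nilpotent_alg F -> exists N, forall x, power_submod N x -> x = 0.
Proof.
move=> [N N0 FN]; exists N; apply: power_submod_min (@submod_zero _ _) _.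
move=> j x Nj xj; apply: FN; apply: is_product_shorten xj.
by rewrite N0 ltnW.
Qed.

Lemma raises_powers_of_products (r : endo F) :
  (forall j x, is_product j x -> is_product j.+1 (r x)) -> raises_powers r.
Proof.
move=> rP m; apply: (@power_submod_min m [set x | power_submod m.+1 (r x)]).
  apply/submod_setP; have Us := power_submod_closed m.+1.
  split=> [|a u v]; rewrite /= ?endo0 ?endo_linear; first exact: submod0.
  exact: submodZD.
by move=> j x mj xj; apply: power_submod_product (rP _ _ xj).
Qed.

Lemma raises_powers_lmul x : raises_powers (lmul x).
Proof.
apply: raises_powers_of_products => j y yj.
by rewrite -add1n; apply: is_product_mul yj; exact: is_product_one.
Qed.

Lemma raises_powers_rmul x : raises_powers (rmul x).
Proof.
apply: raises_powers_of_products => j y yj.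
by rewrite -addn1; apply: is_product_mul yj _; exact: is_product_one.
Qed.

(** Writing [x = v + r v] with [v] on the same level as [x] gives [(g - 1) x = - r v], one level
    deeper. *)
Lemma raises_powers_inverse (r g : endo F) : nilpotent_alg F ->
  raises_powers r -> cancel (1 + r : endo F) g -> raises_powers (g - 1).
Proof.
move=> /power_submod_nilpotent[N UN] Ur rK m x Ux.
have UB j u v : power_submod j u -> power_submod j v -> power_submod j (u - v).
  exact: submodB (power_submod_closed j) u v.
have [v Uv <-] := strict_solve UN power_submodS UB (endoB r) Ur Ux.
have -> : (g - 1) (v + r v) = - r v.
  have -> : (g - 1) (v + r v) = g ((1 + r) v) - (v + r v) by [].
  by rewrite rK opprD addrA subrr sub0r.
exact (submodN (power_submod_closed m.+1) (Ur m v Uv)).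
Qed.

Lemma nilpotent_inverse (r : endo F) : nilpotent_alg F -> raises_powers r ->
  exists g : endo F, cancel (1 + r : endo F) g /\ cancel g (1 + r : endo F).
Proof.
move=> /power_submod_nilpotent[N UN] Ur.
have UB j u v : power_submod j u -> power_submod j v -> power_submod j (u - v).
  exact: submodB (power_submod_closed j) u v.
apply: endo_inverse => [w|].
  have [v _ vw] :=
    strict_solve UN power_submodS UB (endoB r) Ur (power_submod0 w).
  by exists v.
exact: (strict_injective power_submod0 UN UB (endoB r) Ur).
Qed.

Lemma raises_powers_subalgebra : is_subalgebra raises_powers.
Proof.
split.
  apply/submod_setP; split=> [m x _|a r s rP sP m x Ux].
    exact: (submod0 (power_submod_closed m.+1)).
  apply: (submodZD (power_submod_closed m.+1)); [exact: rP|exact: sP].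
move=> r s; rewrite !inE => rP sP m x Ux.
exact: (rP m _ (power_submodS (sP m _ Ux))).
Qed.

End PowerFiltration.

(** * Matrices of endomorphisms acting on columns *)

Section MatrixAction.
Variables (k : comPzRingType) (V : lmodType k) (n : nat).
Implicit Types r : 'M[endo V]_n.

Lemma endo_mx_actB r : {morph endo_mx_act r : u v / u - v}.
Proof.
move=> u v; apply/colP => i; rewrite !mxE -sumrB.
by apply: eq_bigr => j _; rewrite !mxE endoB.
Qed.

Lemma endo_mx_act1D r (v : 'cV[V]_n) :
  endo_mx_act (1%:M + r) v = v + endo_mx_act r v.
Proof.
apply/colP => i; rewrite !mxE.
under eq_bigr => j _ do rewrite !mxE endo_addE.
rewrite big_split /=; congr (_ + _).
rewrite (bigD1 i) //= eqxx big1 ?addr0 // => j /negPf ji.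
by rewrite eq_sym ji.
Qed.

End MatrixAction.

Section Intertwining.
Variables (k : comPzRingType) (n : nat) (V W : lmodType k).
Variable f : {linear V -> W}.

Lemma endo_mx_act_intertwine (r : 'M[endo V]_n) (s : 'M[endo W]_n) :
  (forall i j x, f (r i j x) = s i j (f x)) ->
  forall v, map_mx f (endo_mx_act r v) = endo_mx_act s (map_mx f v).
Proof.
move=> fr v; apply/colP => i; rewrite !mxE linear_sum.
by apply: eq_bigr => j _; rewrite fr mxE.
Qed.

End Intertwining.

(** * Lifting endomorphisms of [B] to the inverse limit *)

Section Lifting.
Variables (k : comPzRingType) (A B : nonassocAlgType k) (h : {linear A -> B}).
Variables (d : Order.disp_t) (I : porderType d) (F : I -> nonassocAlgType k).
Variable f : forall i j : I, (i <= j)%O -> {linear F i -> F j}.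
Variable p : forall i : I, {linear A -> F i}.
Hypotheses (h_mul : {morph h : x y / x ** y}) (h_surj : surjective h).
Hypotheses (Fnil : forall i, nilpotent_alg (F i)) (Fsys : is_inverse_system f).
Hypothesis Alim : is_inverse_limit f p.

(** Since the projections [p i] may fail to be surjective, compatibility with the connecting maps
    does not follow from compatibility with the [p i] and is demanded separately. *)
Definition lifts (r : endo B) (r' : endo A) (ri : forall i, endo (F i)) :=
  [/\ forall a, h (r' a) = r (h a), forall i a, p i (r' a) = ri i (p i a),
      forall i j (ij : (i <= j)%O) x, f ij (ri i x) = ri j (f ij x) &
      forall i, raises_powers (ri i)].

Definition liftable : set (endo B) :=
  [set r | exists r' ri, lifts r r' ri].

Lemma liftable_subalgebra : is_subalgebra liftable.
Proof.
have Us i := (raises_powers_subalgebra (F i)).1.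
split.
  apply/submod_setP; split.
    exists 0, (fun=> 0); split=> [a|i a|i j ij x|i]; rewrite ?linear0 //.
    exact (submod0 (Us i)).
  move=> c r s [r' [ri [hr pr fr Ur]]] [s' [si [hs ps fs Us']]].
  exists (c *: r' + s'), (fun i => c *: ri i + si i).
  split=> [a|i a|i j ij x|i]; rewrite ?endo_addE ?endo_scaleE ?linearP.
  - by rewrite hr hs.
  - by rewrite pr ps.
  - by rewrite fr fs.
  - exact (submodZD (Us i) c (Ur i) (Us' i)).
move=> r s; rewrite !inE => -[r' [ri [hr pr fr Ur]]] [s' [si [hs ps fs Us']]].
exists (r' * s'), (fun i => ri i * si i).
split=> [a|i a|i j ij x|i]; rewrite ?endo_mulE.
- by rewrite hr hs.
- by rewrite pr ps.
- by rewrite fr fs.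
- have := (raises_powers_subalgebra (F i)).2 (ri i) (si i).
  by rewrite !inE; apply.
Qed.

Lemma liftable_lmul (b : B) : liftable (lmul b).
Proof.
have [a <-] := h_surj b; have [pM pf _] := Alim; have [fM _ _] := Fsys.
exists (lmul a), (fun i => lmul (p i a)).
split=> [x|i x|i j ij x|i]; [exact: h_mul|exact: pM| |].
  by rewrite [LHS]fM pf.
exact: raises_powers_lmul.
Qed.

Lemma liftable_rmul (b : B) : liftable (rmul b).
Proof.
have [a <-] := h_surj b; have [pM pf _] := Alim; have [fM _ _] := Fsys.
exists (rmul a), (fun i => rmul (p i a)).
split=> [x|i x|i j ij x|i]; [exact: h_mul|exact: pM| |].
  by rewrite [LHS]fM pf.
exact: raises_powers_rmul.
Qed.

Lemma mult_alg_liftable : mult_alg B `<=` liftable.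
Proof.
move=> r; apply; split; first exact: liftable_subalgebra.
by move=> _ [] [b _ <-]; [exact: liftable_lmul|exact: liftable_rmul].
Qed.

Lemma limit_ext (a a' : A) : (forall i, p i a = p i a') -> a = a'.
Proof.
have [_ pf lim] := Alim => pa.
have [|x [_ ux]] := lim (fun i => p i a); first by move=> i j ij; exact: pf.
by rewrite -(ux a) // -(ux a').
Qed.

Section Matrices.
Variables (n : nat) (i : I) (ri : 'M[endo (F i)]_n).
Hypothesis riU : forall a b, raises_powers (ri a b).

Let U m : set 'cV[F i]_n := [set v | forall a, power_submod m (v a 0)].

Lemma strict_mx_data : exists N,
  [/\ forall v, U 0 v, forall v, U N v -> v = 0,
      forall m v, U m.+1 v -> U m v,
      forall m u v, U m u -> U m v -> U m (u - v) &
      forall m v, U m v -> U m.+1 (endo_mx_act ri v)].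
Proof.
have [N NP] := power_submod_nilpotent (Fnil i); exists N; split.
- by move=> v a; exact: power_submod0.
- by move=> v Uv; apply/colP => a; rewrite mxE; exact: NP.
- by move=> m v Uv a; exact: power_submodS.
- by move=> m u v Uu Uv a; rewrite !mxE; exact (submodB
    (power_submod_closed _ m) (Uu a) (Uv a)).
- move=> m v Uv a; rewrite mxE.
  by apply (submod_sum (power_submod_closed _ m.+1)) => b; exact: riU.
Qed.

Lemma level_mx_injective : injective (fun v => v + endo_mx_act ri v).
Proof.
have [N [U0 UN Ua UB TU]] := strict_mx_data.
by apply: (strict_injective U0 UN) => //; exact: endo_mx_actB.
Qed.

Lemma level_mx_solve w : exists v, v + endo_mx_act ri v = w.
Proof.
have [N [U0 UN Ua UB TU]] := strict_mx_data.
have [|v _ vw] := strict_solve UN Ua UB (endo_mx_actB ri) TU (m := 0) (w := w).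
  exact: U0.
by exists v.
Qed.

End Matrices.

(** Each level has exactly one solution. Uniqueness at level [j] makes a connecting map send the
    solution at level [i] to the one at level [j], so the solutions define a column over [A]. *)
Lemma limit_mx_surjective (n : nat) (r' : 'M[endo A]_n)
    (ri : forall i, 'M[endo (F i)]_n) :
  (forall i b c a, p i (r' b c a) = ri i b c (p i a)) ->
  (forall i j (ij : (i <= j)%O) b c x,
    f ij (ri i b c x) = ri j b c (f ij x)) ->
  (forall i b c, raises_powers (ri i b c)) ->
  surjective (fun v => v + endo_mx_act r' v).
Proof.
move=> pr fr Ur w; have [_ pf lim] := Alim.
have g i : {v | v + endo_mx_act (ri i) v = map_mx (p i) w}.
  by apply: cid; exact: level_mx_solve (Ur i) _.
have gf i j (ij : (i <= j)%O) : map_mx (f ij) (sval (g i)) = sval (g j).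
  apply: (level_mx_injective (Ur j)); rewrite /= (svalP (g j)).
  rewrite -(endo_mx_act_intertwine (fr i j ij)) -map_mxD (svalP (g i)).
  by apply/colP => b; rewrite !mxE; exact: pf.
have /choice[v vP] b : exists a, forall i, p i a = sval (g i) b 0.
  have [|a [aP _]] := lim (fun i => sval (g i) b 0); last by exists a.
  by move=> i j ij; rewrite -(gf i j ij) mxE.
exists (\col_b v b); apply/colP => b; apply: limit_ext => i.
have -> : p i (w b 0) = (sval (g i) + endo_mx_act (ri i) (sval (g i))) b 0.
  by rewrite (svalP (g i)) mxE.
have <- : map_mx (p i) (\col_b v b) = sval (g i).
  by apply/colP => c; rewrite !mxE vP.
rewrite -(endo_mx_act_intertwine (pr i)) -map_mxD.
by rewrite [RHS]mxE.
Qed.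

Lemma liftable_mx_surjective (n : nat) (r : 'M[endo B]_n) :
  (forall b c, liftable (r b c)) -> surjective (endo_mx_act (1%:M + r)).
Proof.
move=> rl w.
have l b c : {x : endo A * (forall i, endo (F i)) | lifts (r b c) x.1 x.2}.
  by apply: cid; have [r' [ri riP]] := rl b c; exists (r', ri).
pose r' := \matrix_(b, c) (sval (l b c)).1.
pose ri i := \matrix_(b, c) (sval (l b c)).2 i.
have hr b c a : h (r' b c a) = r b c (h a).
  by rewrite mxE; have [] := svalP (l b c).
(* A set-theoretic section suffices: the equation is solved over [A] for a lifted right-hand side
   and pushed down by [h]. *)
have [hi hiK] := choice h_surj.
have [|||w' w'P] := @limit_mx_surjective n r' ri _ _ _ (map_mx hi w).
- by move=> i b c a; rewrite !mxE; have [] := svalP (l b c).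
- by move=> i j ij b c x; rewrite !mxE; have [] := svalP (l b c).
- by move=> i b c; rewrite !mxE; have [] := svalP (l b c).
exists (map_mx h w').
rewrite endo_mx_act1D -(endo_mx_act_intertwine hr) -map_mxD w'P.
by apply/colP => b; rewrite !mxE; exact: hiK.
Qed.

(** Surjectivity is the case of 1 by 1 matrices. Injectivity holds at every level and passes to [A],
    whose elements are determined by their projections. *)
Lemma one_plus_lift_bijective (r' : endo A) (ri : forall i, endo (F i)) :
  (forall i a, p i (r' a) = ri i (p i a)) ->
  (forall i j (ij : (i <= j)%O) x, f ij (ri i x) = ri j (f ij x)) ->
  (forall i, raises_powers (ri i)) ->
  exists g : endo A, cancel (1 + r' : endo A) g /\ cancel g (1 + r' : endo A).
Proof.
move=> pr fr Ur; apply: endo_inverse => [a|a a' eq_aa'].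
  have [|||v vP] := @limit_mx_surjective 1 (const_mx r')
      (fun i => const_mx (ri i)) _ _ _ (const_mx a).
  - by move=> *; rewrite !mxE.
  - by move=> *; rewrite !mxE.
  - by move=> *; rewrite mxE.
  exists (v 0 0); have /(congr1 (fun u : 'cV_1 => u 0 0)) := vP.
  by rewrite !mxE big_ord1 mxE.
apply: limit_ext => i; have [g [gK _]] := nilpotent_inverse (Fnil i) (Ur i).
apply: (can_inj gK); rewrite !endo_addE -!pr -!linearD.
exact: congr1 eq_aa'.
Qed.

Lemma liftable_surjective (r : endo B) :
  liftable r -> surjective (1 + r : endo B).
Proof.
move=> rl b.
have [|v vP] := @liftable_mx_surjective 1 (const_mx r) _ (const_mx b).
  by move=> *; rewrite mxE.
exists (v 0 0); have /(congr1 (fun u : 'cV_1 => u 0 0)) := vP.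
by rewrite endo_mx_act1D !mxE big_ord1 mxE.
Qed.

Lemma liftable_jacobson_radical : hopfian B -> jacobson_radical liftable.
Proof.
move=> hopf r rl; have r_surj := liftable_surjective rl.
have [g [gK Kg]] := endo_inverse r_surj (bij_inj (hopf _ r_surj)).
have [r' [ri [hr pr fr Ur]]] := rl.
have [g' [g'K Kg']] := one_plus_lift_bijective pr fr Ur.
have G i : {e : endo (F i) | cancel (1 + ri i : endo (F i)) e /\
    cancel e (1 + ri i : endo (F i))}.
  by apply: cid; exact: nilpotent_inverse.
exists (g - 1).
  exists (g' - 1), (fun i => sval (G i) - 1); split.
  - exact: inverse_intertwine hr Kg' gK.
  - by move=> i; apply: inverse_intertwine (pr i) Kg' (svalP (G i)).1.
  - move=> i j ij.
    exact: inverse_intertwine (fr i j ij) (svalP (G i)).2 (svalP (G j)).1.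
  - by move=> i; apply: raises_powers_inverse (svalP (G i)).1.
have rg : (1 + r) * g = 1 by apply: endo_ext => x; exact: Kg.
have gr : g * (1 + r) = 1 by apply: endo_ext => x; exact: gK.
rewrite mulrBr mulrBl mulr1 mul1r.
rewrite mulrDl mul1r in rg; rewrite mulrDr mulr1 in gr.
(* Both quasiinverse identities have this shape, with [a] equal to [r * g] and to [g * r]. *)
have e (a : endo B) : g + a = 1 -> r + (g - 1) + (a - r) = 0.
  by move=> <-; rewrite opprD [g + _]addrA subrr add0r -(opprB r a) subrr.
by split; exact: e.
Qed.

End Lifting.

Theorem theorem10 (k : comPzRingType) (A B : nonassocAlgType k)
    (h : {linear A -> B})
    (A_pronil : pro_nilpotent A)
    (h_mul : {morph h : x y / x ** y})
    (h_surj : surjective h) :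
  [/\ (forall r : endo B, mult_alg B r -> surjective (1 + r : endo B)) /\
      (forall (n : nat) (r : 'M[endo B]_n), (0 < n)%N ->
         (forall i j : 'I_n, mult_alg B (r i j)) ->
         surjective (endo_mx_act (1%:M + r))),
      hopfian B ->
        exists S : set (endo B),
          [/\ is_subalgebra S, jacobson_radical S & mult_alg B `<=` S] &
      finite_length B -> nilpotent_alg B].
Proof.
have [d [I [F [f [p [_ Fnil Fsys Alim]]]]]] := A_pronil.
have sub := mult_alg_liftable h_mul h_surj Fsys Alim.
have Ssub : is_subalgebra (liftable h f p) by exact: liftable_subalgebra.
have Srad : hopfian B -> jacobson_radical (liftable h f p).
  exact: liftable_jacobson_radical.
split; first split.
- by move=> r /sub; exact: liftable_surjective.
- by move=> n r _ rM; apply: (liftable_mx_surjective h_surj Fnil Alim) => b c;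
    exact: sub.
- by move=> hopf; exists (liftable h f p); split; [|exact: Srad|].
- move=> Bfl; apply: (radical_nilpotent_alg Ssub) => //.
  + exact/Srad/finite_length_hopfian.
  + by move=> x; exact: liftable_lmul.
  + by move=> x; exact: liftable_rmul.
Qed.
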